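(* Suppose that a group $\Gamma=\Gamma_1\times \Gamma_2$ acts geometrically on a CAT(0) space $X$. If the center of $\Gamma$ is finite, then there exists a closed, convex, $\Gamma$-invariant, quasi-dense subspace $X'\subset X$ such that $X'$ splits as a product $X_1 \times X_2$ and the action of $\Gamma=\Gamma_1\times \Gamma_2$ on $X'=X_1 \times X_2$ is the product action.
   Context: A geometric action of a group $\Gamma$ on a CAT(0) space $X$ is an action by isometries that is proper (every $x\in X$ has some $r>0$ such that $\{\gamma\in\Gamma : \gamma B(x,r)\cap B(x,r)\ne\emptyset\}$ is finite) and cocompact (there is a compact $K\subset X$ with $\Gamma K=X$). A subset $X'$ of a metric space $X$ is quasi-dense if there is $N>0$ such that each point of $X$ is within distance $N$ of some point of $X'$. ''$X'$ splits as a product $X_1\times X_2$'' means that $X'$ is isometric to $X_1\times X_2$ with the $\ell^2$ product metric. The action of $\Gamma_1\times\Gamma_2$ on $X_1\times X_2$ is the product action if there are isometric actions of $\Gamma_1$ on $X_1$ and of $\Gamma_2$ on $X_2$ with $(\gamma_1,\gamma_2)\cdot(x_1,x_2)=(\gamma_1x_1,\gamma_2x_2)$ for all $\gamma_i\in\Gamma_i$, $x_i\in X_i$. *)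

(* Defs.v *)
From HB Require Import structures.
From mathcomp Require Import all_boot all_order all_algebra.
From mathcomp Require Import all_classical all_reals all_analysis.
From mathcomp Require Import ring.

Set Implicit Arguments.
Unset Strict Implicit.
Unset Printing Implicit Defensive.
Import Order.TTheory GRing.Theory Num.Theory.
Import numFieldNormedType.Exports.
Local Open Scope classical_set_scope.
Local Open Scope ring_scope.

(* The library puts the sup (pseudo)metric on X1 * X2, hence this alias. *)
Definition l2prod (X1 X2 : Type) : Type := (X1 * X2)%type.

Section L2Product.
Context {R : realType} {X1 X2 : metricType R}.

Definition l2dist (p q : l2prod X1 X2) : R :=
  Num.sqrt (mdist p.1 q.1 ^+ 2 + mdist p.2 q.2 ^+ 2).

Let l2distxx p : l2dist p p = 0.
Proof. by rewrite /l2dist !mdistxx expr0n addr0 sqrtr0. Qed.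

Let l2dist_positivity p q : l2dist p q = 0 -> p = q.
Proof.
move=> /eqP; rewrite sqrtr_eq0 => le0.
have /andP[/eqP e1 /eqP e2] :
    (mdist p.1 q.1 ^+ 2 == 0) && (mdist p.2 q.2 ^+ 2 == 0).
  by rewrite -paddr_eq0 ?sqr_ge0// eq_le le0 addr_ge0 ?sqr_ge0.
case: p q e1 e2 {le0} => [p1 p2] [q1 q2] /= /eqP + /eqP.
by rewrite !sqrf_eq0 => /eqP/mdist_positivity -> /eqP/mdist_positivity ->.
Qed.

Let l2dist_sym p q : l2dist p q = l2dist q p.
Proof. by rewrite /l2dist (metric_sym p.1) (metric_sym p.2). Qed.

Let l2dist_triangle q p r : l2dist p r <= l2dist p q + l2dist q r.
Proof.
rewrite /l2dist.
move: (metric_triangle p.1 q.1 r.1) (metric_triangle p.2 q.2 r.2).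
move: (mdist_ge0 p.1 r.1) (mdist_ge0 p.2 r.2).
move: (mdist p.1 r.1) (mdist p.2 r.2) => a b a0 b0.
move: (mdist p.1 q.1) (mdist q.1 r.1) => a1 a2 lea.
move: (mdist p.2 q.2) (mdist q.2 r.2) => b1 b2 leb.
set u := Num.sqrt (a1 ^+ 2 + _); set v := Num.sqrt (a2 ^+ 2 + _).
have u0 : 0 <= u by exact: sqrtr_ge0.
have v0 : 0 <= v by exact: sqrtr_ge0.
have uE : u ^+ 2 = a1 ^+ 2 + b1 ^+ 2 by rewrite sqr_sqrtr ?addr_ge0 ?sqr_ge0.
have vE : v ^+ 2 = a2 ^+ 2 + b2 ^+ 2 by rewrite sqr_sqrtr ?addr_ge0 ?sqr_ge0.
have cs : a1 * a2 + b1 * b2 <= u * v.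
  apply: le_trans (ler_norm _) _; rewrite -(ger0_norm (mulr_ge0 u0 v0)).
  rewrite -ler_sqr ?nnegrE// !real_normK ?num_real//.
  rewrite exprMn uE vE -subr_ge0.
  rewrite [leRHS](_ : _ = (a1 * b2 - a2 * b1) ^+ 2) ?sqr_ge0//.
  by rewrite !expr2; ring.
rewrite -[leRHS]ger0_norm ?addr_ge0// -sqrtr_sqr ler_wsqrtr//.
have sqa : a ^+ 2 <= (a1 + a2) ^+ 2 by rewrite lerXn2r ?nnegrE// (le_trans a0).
have sqb : b ^+ 2 <= (b1 + b2) ^+ 2 by rewrite lerXn2r ?nnegrE// (le_trans b0).
rewrite (le_trans (lerD sqa sqb))// !sqrrD uE vE -subr_ge0.
rewrite [leRHS](_ : _ = (u * v - (a1 * a2 + b1 * b2)) *+ 2).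
  by rewrite mulrn_wge0// subr_ge0.
by rewrite !mulr2n; ring.
Qed.

HB.instance Definition _ := Choice.copy (l2prod X1 X2) (X1 * X2)%type.
HB.instance Definition _ := isMetric.Build R (l2prod X1 X2)
  l2distxx l2dist_positivity l2dist_sym l2dist_triangle.

End L2Product.

Section CAT0.
Context {R : realType}.

Definition euclidean_plane : metricType R := l2prod R^o R^o.

Definition isometric_map (X Y : metricType R) (f : X -> Y) : Prop :=
  forall x y, mdist (f x) (f y) = mdist x y.

(* Only the values of c on [0, d(x, y)] matter. *)
Definition geodesic (X : metricType R) (c : R -> X) (x y : X) : Prop :=
  [/\ c 0 = x, c (mdist x y) = y &
      {in `[0, mdist x y] &, forall s t, mdist (c s) (c t) = `|s - t|}].

Definition geodesic_space (X : metricType R) : Prop :=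
  forall x y : X, exists c, geodesic c x y.

(* The vertices are v 0, v 1, v 2; addition in 'I_3 is modulo 3, so the sides
   c i go v 0 -> v 1 -> v 2 -> v 0. *)
Definition geodesic_triangle (X : metricType R)
    (v : 'I_3 -> X) (c : 'I_3 -> R -> X) : Prop :=
  forall i, geodesic (c i) (v i) (v (i + 1)).

(* The comparison point of c i s is the point c' i s at distance s from v' i on
   the corresponding side of a comparison triangle (v', c'). *)
Definition CAT0 (X : metricType R) : Prop :=
  geodesic_space X /\
  forall (v : 'I_3 -> X) (c : 'I_3 -> R -> X)
         (v' : 'I_3 -> euclidean_plane) (c' : 'I_3 -> R -> euclidean_plane),
    geodesic_triangle v c -> geodesic_triangle v' c' ->
    (forall i, mdist (v' i) (v' (i + 1)) = mdist (v i) (v (i + 1))) ->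
    forall (i j : 'I_3) (s t : R),
      s \in `[0, mdist (v i) (v (i + 1))] ->
      t \in `[0, mdist (v j) (v (j + 1))] ->
      mdist (c i s) (c j t) <= mdist (c' i s) (c' j t).

Definition geodesically_convex (X : metricType R) (A : set X) : Prop :=
  forall x y, A x -> A y ->
    (exists c, geodesic c x y) /\
    (forall c, geodesic c x y -> forall t, t \in `[0, mdist x y] -> A (c t)).

Definition quasi_dense (X : metricType R) (A : set X) : Prop :=
  exists2 N : R, 0 < N & forall x, exists2 a, A a & mdist x a <= N.

End CAT0.

Definition group_center (G : groupType) : set G :=
  [set z | forall g, (z * g = g * z)%g].

Section Actions.
Context {R : realType} {G : groupType} {X : metricType R}.
Implicit Type act : G -> X -> X.

Definition isometric_action act : Prop :=
  [/\ forall x, act 1%g x = x,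
      forall g h x, act (g * h)%g x = act g (act h x) &
      forall g, isometric_map (act g)].

Definition proper_action act : Prop :=
  forall x, exists2 r : R, 0 < r &
    finite_set [set g | (act g @` ball x r) `&` ball x r !=set0].

Definition cocompact_action act : Prop :=
  exists2 K : set X, compact K & \bigcup_g (act g @` K) = [set: X].

Definition geometric_action act : Prop :=
  [/\ isometric_action act, proper_action act & cocompact_action act].

Definition invariant_set act (A : set X) : Prop :=
  forall g, act g @` A = A.

End Actions.

(* f identifies X1 x X2 (with the l2 metric) with A isometrically. *)
Definition splits_as {R : realType} {X X1 X2 : metricType R} (A : set X)
    (f : l2prod X1 X2 -> X) : Prop :=
  isometric_map f /\ range f = A.

(* The action is read on X1 x X2 through the identification f. *)
Definition is_product_action {R : realType} {G1 G2 : groupType}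
    {X X1 X2 : metricType R} (act : G1 * G2 -> X -> X)
    (f : l2prod X1 X2 -> X) : Prop :=
  exists (act1 : G1 -> X1 -> X1) (act2 : G2 -> X2 -> X2),
    [/\ isometric_action act1, isometric_action act2 &
        forall g1 g2 x1 x2,
          act (g1, g2) (f (x1, x2)) = f (act1 g1 x1, act2 g2 x2)].

(* Main.v *)
Require Import Defs.
From mathcomp Require Import all_boot all_order all_algebra.
From mathcomp Require Import all_classical all_reals all_analysis.
From mathcomp Require Import ring lra.
From HB Require Import structures.

(** The geometry rests on one consequence of the CAT(0) condition, the CN inequality
    of Bruhat and Tits along geodesics. It yields convexity of the metric, nearest
    points on complete convex sets, and bounds on the diagonals of quadrilaterals.

    A geometric action on a geodesic space makes the group finitely generated, has
    finitely many elements of bounded displacement, and makes X complete with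
    compact closed balls. Combined with a finite center this gives the pigeonhole
    principle behind the theorem ([finite_of_finite_conjugates]): a set of group
    elements with finitely many conjugates of each generator is finite.

    The points displaced by at most c by each generator of G2 form a closed convex
    set that is invariant under G1, since G1 and G2 commute. By the principle for
    G2, the action of G1 on it is cocompact ([little_displaced_cobounded]), hence
    Zorn's lemma provides a minimal closed convex G1-invariant subset C. Minimality
    forces every continuous convex G1-invariant function on C to be constant.

    An isometric selfmap of C that commutes with G1 displaces all points of C
    equally. If it were not the identity, approximating its iterates by elements of
    G1 would contradict the principle for G1 ([equivariant_selfmap_id]); this
    excludes the Euclidean translations that an infinite center would allow.
    Consequently two G1-equivariant isometric embeddings of C in X are parallel,
    and their images bound a flat product of C with a segment
    ([embeddings_parallel]).

    The subspace X' is the union of the images of all such embeddings. It is closed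
    and convex because embeddings can be passed to the limit and interpolated. It
    splits as the product of C and the set of embeddings; the latter is identified
    with the set of images of a base point of C. An element of G1 acts on the first
    factor, and an element of G2 sends an embedding phi to another one, its composite
    with phi, thereby acting on the second factor. Quasi-density is automatic for a
    nonempty invariant set under a cocompact action. *)

Set Implicit Arguments.
Unset Strict Implicit.
Unset Printing Implicit Defensive.
Import Order.TTheory GRing.Theory Num.Theory.
Local Open Scope classical_set_scope.
Local Open Scope ring_scope.

Local Notation d := mdist.

(** * The CN inequality of Bruhat and Tits *)

Section EuclideanPlane.
Context {R : realType}.
Implicit Types p q : @euclidean_plane R.

Definition xcoord p : R := p.1.
Definition ycoord p : R := p.2.

Lemma euclidean_distE p q :
  d p q = Num.sqrt ((xcoord q - xcoord p) ^+ 2 + (ycoord q - ycoord p) ^+ 2).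
Proof.
rewrite /mdist/= /l2dist/= /mdist/=.
by rewrite !real_normK ?num_real.
Qed.

Lemma euclidean_sqr_dist p q :
  d p q ^+ 2 = (xcoord q - xcoord p) ^+ 2 + (ycoord q - ycoord p) ^+ 2.
Proof. by rewrite euclidean_distE sqr_sqrtr// addr_ge0 ?sqr_ge0. Qed.

Definition euclidean_point (a b : R) : @euclidean_plane R := (a, b).

Definition euclidean_segment p q (t : R) : @euclidean_plane R :=
  euclidean_point (xcoord p + t / d p q * (xcoord q - xcoord p))
                  (ycoord p + t / d p q * (ycoord q - ycoord p)).

Lemma euclidean_segment_geodesic p q : geodesic (euclidean_segment p q) p q.
Proof.
rewrite /euclidean_segment; have [pq|pq0] := eqVneq (d p q) 0.
  rewrite pq; split=> /=.
  - by rewrite !mul0r !addr0; case: (p).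
  - by rewrite !invr0 !mulr0 !mul0r !addr0 -(@mdist_positivity _ _ p q pq); case: (p).
  - move=> s t; rewrite !in_itv/= pq => /le_anti<- /le_anti<-.
    by rewrite subrr normr0 mdistxx.
split=> /=.
- by rewrite !mul0r !addr0; case: (p).
- by rewrite divff// !mul1r !subrKC; case: (q).
- move=> s t _ _; rewrite euclidean_distE -(sqrtr_sqr (s - t)).
  congr Num.sqrt; rewrite /xcoord/ycoord/= -/(xcoord _) -/(ycoord _).
  transitivity ((s - t) ^+ 2 / d p q ^+ 2 *
    ((xcoord q - xcoord p) ^+ 2 + (ycoord q - ycoord p) ^+ 2)).
    by field.
  by rewrite -euclidean_sqr_dist divfK// expf_neq0.
Qed.

End EuclideanPlane.

Section CN_inequality.
Context {R : realType} {X : metricType R}.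

Let ord3_ind (P : 'I_3 -> Prop) : P 0 -> P 1 -> P (1 + 1) -> forall i, P i.
Proof.
move=> P0 P1 P2 [[|[|[|//]]] i3].
- by rewrite (_ : Ordinal i3 = 0)//; apply/val_inj.
- by rewrite (_ : Ordinal i3 = 1)//; apply/val_inj.
- by rewrite (_ : Ordinal i3 = 1 + 1)//; apply/val_inj.
Qed.

Let ord3_case (T : Type) (a b c : T) (i : 'I_3) : T :=
  if i == 0 then a else if i == 1 then b else c.

Lemma comparison_triangle (x y z : X) : x != y ->
  exists p : @euclidean_plane R,
    [/\ d (euclidean_point 0 0) (euclidean_point (d x y) 0) = d x y,
        d (euclidean_point (d x y) 0) p = d y z &
        d p (euclidean_point 0 0) = d z x].
Proof.
rewrite -mdist_gt0 => D0.
have Dn0 := lt0r_neq0 D0.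
set D := d x y in D0 Dn0 *; set b := d z x; set e := d y z.
have b0 : 0 <= b by exact: mdist_ge0.
have e0 : 0 <= e by exact: mdist_ge0.
have t1 : D <= b + e.
  by have := metric_triangle x z y; rewrite (metric_sym x z) (metric_sym z y).
have t2 : b <= D + e.
  have := metric_triangle z y x.
  by rewrite (metric_sym z y) (metric_sym y x) addrC.
have t3 : e <= D + b.
  by have := metric_triangle y x z; rewrite (metric_sym y x) (metric_sym x z).
(* p = (u, w) with u given by the law of cosines *)
pose u := (b ^+ 2 + D ^+ 2 - e ^+ 2) / (2 * D).
have w0 : 0 <= b ^+ 2 - u ^+ 2.
  (* Heron's formula for the height w of the triangle over its base *)
  have -> : b ^+ 2 - u ^+ 2 =
     (b + D - e) * (b + D + e) * ((e - b + D) * (e + b - D)) / (2 * D) ^+ 2.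
    by rewrite /u; field.
  rewrite divr_ge0 ?sqr_ge0// !mulr_ge0//; lra.
pose w := Num.sqrt (b ^+ 2 - u ^+ 2).
have w2 : w ^+ 2 = b ^+ 2 - u ^+ 2 by rewrite sqr_sqrtr.
exists (euclidean_point u w); rewrite !euclidean_distE /xcoord /ycoord /=; split.
- by rewrite !subr0 expr0n addr0 sqrtr_sqr ger0_norm// ltW.
- rewrite subr0 w2 -[RHS]ger0_norm// -sqrtr_sqr; congr Num.sqrt.
  by rewrite /u; field.
- rewrite !sub0r !sqrrN w2 -[RHS]ger0_norm// -sqrtr_sqr; congr Num.sqrt.
  by rewrite subrKC.
Qed.

(** The square of the distance to z along a geodesic is at least as convex as in
    the plane. This is the comparison inequality between a vertex and a point of
    the opposite side, the latter computed by Stewart's theorem. It is multiplied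
    by d x y so that it also makes sense for x = y. *)
Lemma CAT0_CN (x y z : X) (c : R -> X) (t : R) : CAT0 X -> geodesic c x y ->
  t \in `[0, d x y] ->
  d x y * d z (c t) ^+ 2 <= (d x y - t) * d z x ^+ 2 + t * d z y ^+ 2
    - t * (d x y - t) * d x y.
Proof.
move=> [geo cat0] cxy t_itv.
have [xy|xy] := eqVneq x y.
  move: t_itv; rewrite xy mdistxx in_itv/= => /le_anti <-.
  by rewrite !mul0r !subr0 !mul0r addr0.
have [p [dxy dyz dzx]] := comparison_triangle z xy.
have [cyz cyzP] := geo y z; have [czx czxP] := geo z x.
pose v := ord3_case x y z; pose k := ord3_case c cyz czx.
pose v' := ord3_case (euclidean_point 0 0) (euclidean_point (d x y) 0) p.
pose k' i := euclidean_segment (v' i) (v' (i + 1)).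
have kP : geodesic_triangle v k by apply: ord3_ind.
have k'P : geodesic_triangle v' k'.
  by move=> i; exact: euclidean_segment_geodesic.
have vv' i : d (v' i) (v' (i + 1)) = d (v i) (v (i + 1)) by elim/ord3_ind: i.
have := cat0 v k v' k' kP k'P vv' 0 (1 + 1) t 0 t_itv.
rewrite in_itv/= lexx mdist_ge0 => /(_ isT).
have -> : k (1 + 1) 0 = z by case: czxP.
have -> : k' (1 + 1) 0 = p.
  by rewrite /k' /euclidean_segment !mul0r !addr0 /v' /ord3_case/=; case: (p).
rewrite metric_sym => le.
have D0 : 0 < d x y by rewrite mdist_gt0.
have Dn0 := lt0r_neq0 D0.
move: t_itv; rewrite in_itv/= => /andP[t0 tD].
have {}le : d z (c t) ^+ 2 <= d (k' 0 t) p ^+ 2.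
  by rewrite ler_sqr ?nnegrE ?mdist_ge0.
apply: (le_trans (ler_wpM2l (ltW D0) le)).
rewrite (metric_sym z y) -dyz -dzx !euclidean_sqr_dist /xcoord /ycoord.
rewrite /k' /euclidean_segment /v' /ord3_case/= dxy.
rewrite le_eqVlt; apply/orP; left; apply/eqP.
by field.
Qed.

End CN_inequality.

Lemma le_of_sqr (R : realDomainType) (a b : R) :
  0 <= b -> a ^+ 2 <= b ^+ 2 -> a <= b.
Proof.
move=> b0 ab; have [a0|a0] := leP a 0; first exact: le_trans b0.
by rewrite -ler_sqr ?nnegrE// ltW.
Qed.

Section Barycenter.
Context {R : realType} {X : metricType R}.

(** pt x y s plays the role of the point (1 - s) x + s y. Besides the
    existence of geodesics, the CAT(0) hypothesis enters only through such a choice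
    of points. *)
Definition barycenter (pt : X -> X -> R -> X) : Prop :=
  forall x y z (s : R), 0 <= s -> s <= 1 ->
    d z (pt x y s) ^+ 2 <=
      (1 - s) * d z x ^+ 2 + s * d z y ^+ 2 - s * (1 - s) * d x y ^+ 2.

Lemma CAT0_barycenter : CAT0 X -> exists pt, barycenter pt.
Proof.
move=> cat0; have [geo _] := cat0.
have [c cP] : exists c : X -> X -> R -> X, forall x y, geodesic (c x y) x y.
  exists (fun x y => projT1 (cid (geo x y))) => x y.
  by case: cid.
exists (fun x y s => c x y (s * d x y)) => x y z s s0 s1.
have [xy|xy] := eqVneq x y.
  have [c0 _ _] := cP x y.
  rewrite -xy !mdistxx !mulr0 expr0n/= mulr0 subr0.
  rewrite xy in c0 *; rewrite c0; lra.
have D0 : 0 < d x y by rewrite mdist_gt0.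
have sD : s * d x y \in `[0, d x y].
  by rewrite in_itv/= mulr_ge0 ?mdist_ge0// ler_piMl// mdist_ge0.
have := CAT0_CN z cat0 (cP x y) sD.
set D := d x y in D0 *; move=> le.
rewrite -(ler_pM2l D0) (le_trans le)//; lra.
Qed.

Lemma geodesic_dist (c : R -> X) x y t : geodesic c x y ->
  t \in `[0, d x y] -> exists s, [/\ 0 <= s, s <= 1,
    d x (c t) = s * d x y & d (c t) y = (1 - s) * d x y].
Proof.
move=> [c0 cD cE]; rewrite in_itv/= => /andP[t0 tD].
have dc : d x (c t) = t.
  rewrite -{1}c0 cE ?in_itv/= ?lexx ?mdist_ge0 ?t0 ?tD//.
  by rewrite sub0r normrN ger0_norm.
have dc' : d (c t) y = d x y - t.
  rewrite -{1}cD cE ?in_itv/= ?lexx ?mdist_ge0 ?t0 ?tD//.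
  by rewrite distrC ger0_norm// subr_ge0.
have [D0|Dn0] := eqVneq (d x y) 0.
  move: tD; rewrite D0 => tD; exists 0; rewrite dc dc' D0 mulr0 mulr0.
  by have -> : t = 0 by [lra]; rewrite subrr lexx ler01.
have Dp : 0 < d x y by rewrite lt_neqAle eq_sym Dn0 mdist_ge0.
exists (t / d x y); rewrite divr_ge0 ?mdist_ge0// ler_pdivrMr// mul1r.
by rewrite dc dc' mulrBl mul1r divfK.
Qed.

End Barycenter.

Section MetricCompleteness.
Context {R : realType} {X : metricType R}.

Definition metric_lim (u : nat -> X) (l : X) : Prop :=
  forall e, 0 < e -> exists N, forall n, (N <= n)%N -> d (u n) l < e.

Definition metric_cauchy (u : nat -> X) : Prop :=
  forall e, 0 < e ->
    exists N, forall m n, (N <= m)%N -> (N <= n)%N -> d (u m) (u n) < e.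

Definition metric_complete (A : set X) : Prop :=
  forall u, metric_cauchy u -> (forall n, A (u n)) ->
    exists2 l, A l & metric_lim u l.

End MetricCompleteness.

Section BarycenterTheory.
Context {R : realType} {X : metricType R}.
Variable pt : X -> X -> R -> X.
Hypothesis ptP : barycenter pt.
Implicit Types (x y z w : X) (s : R) (A : set X).

Let half_ge0 : 0 <= 2^-1 :> R. Proof. by rewrite invr_ge0. Qed.
Let half_le1 : 2^-1 <= 1 :> R. Proof. by rewrite invf_le1// ler1n. Qed.

Lemma dist_barycenter x y s : 0 <= s -> s <= 1 ->
  d x (pt x y s) = s * d x y /\ d (pt x y s) y = (1 - s) * d x y.
Proof.
move=> s0 s1; have D0 := mdist_ge0 x y.
have le1 : d x (pt x y s) <= s * d x y.
  apply: le_of_sqr; first exact: mulr_ge0.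
  have := ptP x y x s0 s1; rewrite mdistxx; lra.
have le2 : d (pt x y s) y <= (1 - s) * d x y.
  apply: le_of_sqr; first by rewrite mulr_ge0// subr_ge0.
  have := ptP x y y s0 s1; rewrite mdistxx (metric_sym y x) (metric_sym y).
  lra.
have := metric_triangle x (pt x y s) y; lra.
Qed.

Lemma barycenter_unique x y s m : 0 <= s -> s <= 1 ->
  d x m = s * d x y -> d m y = (1 - s) * d x y -> m = pt x y s.
Proof.
move=> s0 s1 xm my; apply: mdist_positivity; apply/eqP.
rewrite eq_le mdist_ge0 andbT; apply: le_of_sqr => //.
have := ptP x y m s0 s1; rewrite my (metric_sym m x) xm; lra.
Qed.

Lemma isometry_barycenter (X' : set X) (phi : X -> X) x y s :
  {in X' &, forall u v, d (phi u) (phi v) = d u v} ->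
  0 <= s -> s <= 1 -> X' x -> X' y -> X' (pt x y s) ->
  phi (pt x y s) = pt (phi x) (phi y) s.
Proof.
move=> iso s0 s1 /mem_set xX /mem_set yX /mem_set mX.
have [xm my] := dist_barycenter x y s0 s1.
by apply: barycenter_unique => //; rewrite !iso.
Qed.

(** The CN inequality at x and at z for the midpoint of y and w, followed by the
    triangle inequality through this midpoint. *)
Lemma quadrilateral x y z w :
  d x z ^+ 2 + d y w ^+ 2 <=
    d x y ^+ 2 + d y z ^+ 2 + d z w ^+ 2 + d w x ^+ 2.
Proof.
have := ptP y w x half_ge0 half_le1; have := ptP y w z half_ge0 half_le1.
rewrite (metric_sym z y) (metric_sym x w).
move: (metric_triangle x (pt y w 2^-1) z) (mdist_ge0 x z).
rewrite (metric_sym (pt y w _) z).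
move: (d x (pt y w 2^-1)) (d z (pt y w 2^-1)) => a b ab xz0 zb xa.
have : d x z ^+ 2 <= (a + b) ^+ 2 by rewrite ler_sqr ?nnegrE// (le_trans xz0).
have := sqr_ge0 (a - b); lra.
Qed.

(** Expand by the CN inequality on the segment x' y' and then on x y; the two
    diagonals that appear are absorbed by the quadrilateral inequality. *)
Lemma barycenter_sqr_convex x y x' y' s : 0 <= s -> s <= 1 ->
  d (pt x y s) (pt x' y' s) ^+ 2 <= (1 - s) * d x x' ^+ 2 + s * d y y' ^+ 2.
Proof.
move=> s0 s1; have t0 : 0 <= 1 - s by rewrite subr_ge0.
have := ptP x' y' (pt x y s) s0 s1.
have := ler_wpM2l t0 (ptP x y x' s0 s1).
have := ler_wpM2l s0 (ptP x y y' s0 s1).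
have := ler_wpM2l (mulr_ge0 s0 t0) (quadrilateral x x' y' y).
rewrite (metric_sym (pt x y s) x') (metric_sym (pt x y s) y').
rewrite (metric_sym x' x) (metric_sym y' x) (metric_sym y' y) (metric_sym y x).
lra.
Qed.

Lemma barycenter_dist_le x y x' y' s (r : R) : 0 <= s -> s <= 1 ->
  d x x' <= r -> d y y' <= r -> d (pt x y s) (pt x' y' s) <= r.
Proof.
move=> s0 s1 xr yr; have r0 : 0 <= r := le_trans (mdist_ge0 _ _) xr.
apply: le_of_sqr => //.
apply: le_trans (barycenter_sqr_convex _ _ _ _ s0 s1) _.
have sq t : 0 <= t -> t <= r -> t ^+ 2 <= r ^+ 2.
  by move=> t0 tr; rewrite ler_sqr ?nnegrE.
have t0 : 0 <= 1 - s by rewrite subr_ge0.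
have := ler_wpM2l s0 (sq _ (mdist_ge0 _ _) yr).
have := ler_wpM2l t0 (sq _ (mdist_ge0 _ _) xr); lra.
Qed.

(** Thales' theorem becomes an inequality: the CN inequality is used at z for the
    midpoint of x and y, and at this midpoint for the one of y and z. *)
Lemma midline x y z : 2 * d (pt x y 2^-1) (pt y z 2^-1) <= d x z.
Proof.
have [xm my] := dist_barycenter x y half_ge0 half_le1.
apply: le_of_sqr; first exact: mdist_ge0.
have := ptP y z (pt x y 2^-1) half_ge0 half_le1.
have := ptP x y z half_ge0 half_le1.
rewrite my (metric_sym (pt x y _) z) (metric_sym z x) (metric_sym z y).
lra.
Qed.

Definition barycenter_convex A : Prop :=
  forall x y s, 0 <= s -> s <= 1 -> A x -> A y -> A (pt x y s).

Lemma barycenter_geodesically_convex A : geodesic_space X ->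
  barycenter_convex A -> geodesically_convex A.
Proof.
move=> geo Aconv x y Ax Ay; split; first exact: geo.
move=> c cxy t /(geodesic_dist cxy)[s [s0 s1 xc cy]].
rewrite (barycenter_unique s0 s1 xc cy); exact: Aconv.
Qed.

Definition nearest A z p : Prop := A p /\ forall a, A a -> d z p <= d z a.

(** The angle at the foot of a perpendicular on a convex set is obtuse. *)
Lemma nearest_sqr A z p q : barycenter_convex A -> nearest A z p -> A q ->
  d z p ^+ 2 + d p q ^+ 2 <= d z q ^+ 2.
Proof.
move=> Aconv [Ap pmin] Aq; rewrite leNgt; apply/negP => lt.
(* moving by a small proportion s from p to q would decrease the distance *)
pose D := d p q; pose eps := d z p ^+ 2 + D ^+ 2 - d z q ^+ 2.
have eps0 : 0 < eps by rewrite subr_gt0.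
pose s := eps / (2 * (D ^+ 2 + eps)).
have den0 : 0 < D ^+ 2 + eps by rewrite ltr_wpDl// sqr_ge0.
have s0 : 0 < s by rewrite divr_gt0// mulr_gt0.
have sE : s * (D ^+ 2 + eps) = eps / 2.
  by rewrite /s; field; rewrite lt0r_neq0.
have s1 : s <= 1.
  rewrite ler_pdivrMr ?mulr_gt0// mul1r; have := sqr_ge0 D; lra.
have := pmin _ (Aconv p q s (ltW s0) s1 Ap Aq).
rewrite -ler_sqr ?nnegrE ?mdist_ge0//.
have := ptP p q z (ltW s0) s1; rewrite -/D => h1 h2.
have : 0 <= s * (s * D ^+ 2 - eps) by rewrite /eps; lra.
rewrite pmulr_rge0// => h3.
have : s * eps > 0 by rewrite mulr_gt0.
lra.
Qed.

Lemma nearest_unique A z p q : barycenter_convex A ->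
  nearest A z p -> nearest A z q -> p = q.
Proof.
move=> Aconv pP [Aq qmin]; apply: mdist_positivity; apply/eqP.
rewrite eq_le mdist_ge0 andbT; apply: le_of_sqr => //.
have := nearest_sqr Aconv pP Aq; case: pP => Ap _.
have := qmin _ Ap; rewrite -ler_sqr ?nnegrE ?mdist_ge0//; lra.
Qed.

(** By the CN inequality, two points that almost minimize the distance to z are
    close, because their midpoint cannot be nearer than the infimum. *)
Lemma nearest_exists A z : metric_complete A -> barycenter_convex A ->
  A !=set0 -> exists p, nearest A z p.
Proof.
move=> Acomp Aconv [a0 Aa0].
pose D := [set d z a | a in A]; pose r := inf D.
have D0 : has_inf D.
  split; first by exists (d z a0), a0.
  by exists 0 => _ [a _ <-]; exact: mdist_ge0.
have rle a : A a -> r <= d z a.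
  by move=> Aa; apply: ge_inf; [case: D0|exists a].
have r0 : 0 <= r.
  by apply: lb_le_inf; [case: D0|move=> _ [a _ <-]; exact: mdist_ge0].
have ex n : exists a, A a /\ d z a < r + n.+1%:R^-1.
  have e0 : 0 < n.+1%:R^-1 :> R by rewrite invr_gt0.
  have [_ [a Aa <-] lt] := inf_adherent e0 D0.
  by exists a.
pose u n := projT1 (cid (ex n)).
have uA n : A (u n) by rewrite /u; case: cid => a [].
have ule n : d z (u n) < r + n.+1%:R^-1 by rewrite /u; case: cid => a [].
have small e : 0 < e -> exists N, forall n, (N <= n)%N -> d z (u n) < r + e.
  move=> e0; exists (Num.trunc e^-1) => n Nn.
  rewrite (lt_le_trans (ule n))// lerD2l -[leRHS]invrK lef_pV2 ?posrE ?invr_gt0//.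
  rewrite ltW// (lt_le_trans (truncnS_gt _))// ler_nat ltnS//.
have [l Al ul] : exists2 l, A l & metric_lim u l.
  apply: Acomp => // e e0.
  (* points within r + c of z are at distance at most sqrt (4 c (2 r + c)) *)
  pose c := e ^+ 2 / (8 * (r + 1) + e ^+ 2).
  have e20 : 0 < e ^+ 2 by rewrite exprn_gt0.
  have den0 : 0 < 8 * (r + 1) + e ^+ 2 by lra.
  have c0 : 0 < c by rewrite divr_gt0.
  have c1 : c <= 1 by rewrite ler_pdivrMr// mul1r; lra.
  have cE : c * (8 * (r + 1) + e ^+ 2) = e ^+ 2 by rewrite divfK// lt0r_neq0.
  have [N NP] := small _ c0; exists N => m n /NP lm /NP ln.
  rewrite -ltr_sqr ?nnegrE ?mdist_ge0// ?ltW//.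
  have := ptP (u m) (u n) z half_ge0 half_le1.
  have : r ^+ 2 <= d z (pt (u m) (u n) 2^-1) ^+ 2.
    by rewrite ler_sqr ?nnegrE ?mdist_ge0//; apply/rle/Aconv.
  have sq k : d z (u k) < r + c -> d z (u k) ^+ 2 <= (r + c) ^+ 2.
    by move=> lt; rewrite ler_sqr ?nnegrE ?mdist_ge0 ?ltW// ltr_wpDl.
  have := sq _ lm; have := sq _ ln.
  have : 0 < c * e ^+ 2 by rewrite mulr_gt0.
  have : c * c <= c by rewrite ler_piMr// ltW.
  lra.
exists l; split=> // a /rle; apply: le_trans.
apply/ler_addgt0Pr => e e0.
have e20 : 0 < e / 2 by rewrite divr_gt0.
have [N NP] := small _ e20; have [N' N'P] := ul _ e20.
have := NP (maxn N N') (leq_maxl _ _); have := N'P (maxn N N') (leq_maxr _ _).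
have := metric_triangle z (u (maxn N N')) l; lra.
Qed.

End BarycenterTheory.

(** * Compactness in metric spaces *)

Section MetricTopology.
Context {R : realType} {X : metricType R}.
Implicit Types (x y z : X) (A K : set X).

Lemma nbhs_mdist x (e : R) : 0 < e -> nbhs x [set y | d x y < e].
Proof. by move=> e0; rewrite -ballEmdist; exact: nbhsx_ballx. Qed.

Lemma closed_mdistP A :
  closed A <-> forall x, (forall e, 0 < e -> exists2 a, A a & d x a < e) -> A x.
Proof.
split=> [cA x xA|cA x xA].
  apply: cA => B /nbhs_ballP[e /= e0 eB].
  have [a Aa xa] := xA _ e0; exists a; split => //.
  by apply: eB; rewrite ballEmdist.
apply: cA => e e0; have [a [Aa xa]] := xA _ (nbhs_mdist x e0).
by exists a.
Qed.

Lemma closed_ball_mdist z (r : R) : closed [set x | d z x <= r].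
Proof.
apply/closed_mdistP => x xA; apply/ler_addgt0Pr => e e0.
have [a /= za xa] := xA _ e0.
have := metric_triangle z a x; rewrite (metric_sym a x); lra.
Qed.

(** Compactness in the form that properness needs: a property that holds near each
    point of K for some finite set and some radius, and that persists for larger
    sets and smaller radii, holds on K for a common finite set and radius. *)
Lemma compact_finite_uniform (I : Type) K (P : set I -> R -> X -> Prop) :
  compact K ->
  (forall (A A' : set I) (e e' : R) x, A `<=` A' -> e' <= e ->
     P A e x -> P A' e' x) ->
  (forall x, K x -> exists (A : set I) (e : R), [/\ finite_set A, 0 < e &
     forall x', d x x' < e -> P A e x']) ->
  exists (A : set I) (e : R), [/\ finite_set A, 0 < e & K `<=` P A e].
Proof.
move=> /compact_near_coveringP cK mono loc.
pose D : set (set I * R) := [set p | finite_set p.1 /\ 0 < p.2].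
pose B (p : set I * R) : set (set I * R) :=
  [set q | [/\ D q, p.1 `<=` q.1 & q.2 <= p.2]].
have FF : Filter (filter_from D B).
  apply: filter_from_filter; first by exists (set0, 1); split.
  move=> [A e] [A' e'] [/= fA e0] [/= fA' e'0].
  exists (A `|` A', Num.min e e').
    by split => /=; rewrite ?finite_setU// lt_min e0.
  move=> [A2 e2] [D2 /=]; rewrite subUset le_min => -[AA2 A'A2] /andP[? ?].
  by split; split.
have [x Kx|[A e] [/= fA e0] AeB] := cK _ _ (fun q x => P q.1 q.2 x) FF.
  have [A [e [fA e0 AeP]]] := loc x Kx.
  exists ([set y | d x y < e], B (A, e)).
    split; [exact: (nbhs_mdist x e0)|by exists (A, e)].
  move=> [y [A' e']] [/= xy [_ /= AA' e'e]].
  exact: (mono A A' e e' y AA' e'e (AeP y xy)).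
by exists A, e; split => //; apply: (AeB (A, e)); split.
Qed.

Lemma compact_mdist_bounded x0 K : compact K ->
  exists2 D, 0 < D & forall x, K x -> d x0 x <= D.
Proof.
move=> cK.
pose P (_ : set unit) (e : R) (x : X) := d x0 x * e <= 1.
have [] := @compact_finite_uniform unit K P cK.
- move=> A A' e e' x _ ee'; apply: le_trans.
  by rewrite ler_wpM2l// mdist_ge0.
- move=> x _; exists set0, (d x0 x + 1)^-1.
  have D0 : 0 < d x0 x + 1 by rewrite ltr_pwDr// mdist_ge0.
  split => //; first by rewrite invr_gt0.
  move=> x' xx'; rewrite /P ler_pdivrMr// mul1r.
  rewrite (le_trans (metric_triangle _ x _))// lerD2l ltW// (lt_le_trans xx')//.
  by rewrite invf_le1// lerDr mdist_ge0.
move=> A [e [_ e0 KP]]; exists e^-1; first by rewrite invr_gt0.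
by move=> x /KP; rewrite /P -ler_pdivlMr// mul1r.
Qed.

Lemma compact_cauchy_lim K (u : nat -> X) : compact K -> metric_cauchy u ->
  (exists N, forall n, (N <= n)%N -> K (u n)) -> exists l, metric_lim u l.
Proof.
move=> cK cu [N0 uK].
have [l [_ ul]] : (K `&` cluster (u @ \oo)) !=set0.
  by apply: cK; exists N0.
exists l => e e0; have e20 : 0 < e / 2 by rewrite divr_gt0.
have [N NP] := cu _ e20.
have /ul : (u @ \oo) (u @` [set n | (N <= n)%N]).
  by exists N => // n /= Nn; exists n.
move=> /(_ _ (nbhs_mdist l e20)) [_ [[m /= Nm <-] lm]].
exists N => n Nn; have := NP _ _ Nn Nm.
have := metric_triangle (u n) (u m) l; rewrite (metric_sym (u m) l).
move: lm => /=; lra.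
Qed.

(** The members of a chain generate a filter on the compact set, and a cluster
    point of this filter lies in all of them. *)
Lemma compact_chain_bigcap K (F : set (set X)) : compact K -> F !=set0 ->
  (forall A, F A -> closed A /\ A `&` K !=set0) ->
  total_on F subset -> exists x, forall A, F A -> A x.
Proof.
move=> cK F0 FP tot.
have FF : Filter (filter_from F (fun A => A `&` K)).
  apply: filter_from_filter => // A B FA FB.
  have [AB|BA] := tot _ _ FA FB.
    by exists A => // x [Ax Kx]; split; split => //; exact: AB.
  by exists B => // x [Bx Kx]; split; split => //; exact: BA.
have PF : ProperFilter (filter_from F (fun A => A `&` K)).
  by apply: filter_from_proper => A /FP[].
have [|x [_ xF]] := cK _ PF.
  by have [A FA] := F0; exists A => // x [].
exists x => A FA; have [cA _] := FP _ FA; apply: cA => B xB.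
have [|y [[Ay _] By]] := xF (A `&` K) B _ xB; first by exists A.
by exists y.
Qed.

End MetricTopology.

(** * Finite center and generators *)

Section FiniteConjugates.
Context {G : groupType}.
Implicit Types (S A B : set G) (g s : G).

(** Generation as a monoid, the form in which geodesics provide it. *)
Definition generates S : Prop := forall H : set G, H 1%g ->
  (forall g s, H g -> S s -> H (g * s)%g) -> forall g, H g.

(** Induction on the generators: B is split according to the conjugate of the first
    one. *)
Let finite_of_finite_fibers (l : seq G) B :
  (forall s, s \in l -> finite_set [set (g^-1 * s * g)%g | g in B]) ->
  (forall g0, B g0 -> finite_set [set g | B g /\
     forall s, s \in l -> (g^-1 * s * g = g0^-1 * s * g0)%g]) ->
  finite_set B.
Proof.
elim: l B => [|s l IH] B conjB fibB.
  have [[g0 /fibB fin]|none] := pselect (exists g, B g).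
    by apply: sub_finite_set fin.
  by rewrite (_ : B = set0) ?finite_set0// -subset0 => g Bg; apply: none; exists g.
pose By y := [set g | B g /\ (g^-1 * s * g)%g = y].
apply: (@sub_finite_set _ _
  (\bigcup_(y in [set (g^-1 * s * g)%g | g in B]) By y)).
  by move=> g Bg; exists (g^-1 * s * g)%g; [exists g|split].
apply: bigcup_finite; first by apply: conjB; rewrite mem_head.
move=> y _; apply: IH => [s' ls'|g0 [Bg0 g0y]].
  have := conjB s'; rewrite in_cons ls' orbT => /(_ isT).
  by apply: sub_finite_set => _ [g [Bg _] <-]; exists g.
apply: sub_finite_set (fibB _ Bg0) => g [[Bg gy] gl]; split => // s'.
by rewrite in_cons => /orP[/eqP->|/gl//]; rewrite gy g0y.
Qed.

(** Two elements conjugating every generator in the same way differ by a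
    central element, so that a set of elements with finitely many conjugates
    of each generator meets finitely many cosets of the center only. *)
Lemma finite_of_finite_conjugates S A : finite_set S -> generates S ->
  finite_set (@group_center G) ->
  (forall s, S s -> finite_set [set (g^-1 * s * g)%g | g in A]) ->
  finite_set A.
Proof.
move=> /finite_seqP[l ->] genS finZ conjA.
apply: (finite_of_finite_fibers conjA) => g0 _.
apply: sub_finite_set (finite_image (fun z => z * g0)%g finZ) => g [_ eqg].
exists (g * g0^-1)%g; last by rewrite mulgVK.
apply: genS => [|h s comm ls]; first by rewrite mulg1 mul1g.
have {ls}commS : (g * g0^-1 * s = s * (g * g0^-1))%g.
  have sE : s = (g * (g0^-1 * s * g0) * g^-1)%g.
    by rewrite -eqg// !mulgA mulgV mul1g mulgK.
  by rewrite {2}sE !mulgA mulgVK mulgK.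
by rewrite mulgA comm -mulgA commS mulgA.
Qed.

End FiniteConjugates.

(** * Geometric actions *)

Section IsometricAction.
Context {R : realType} {G : groupType} {X : metricType R} {act : G -> X -> X}.
Hypothesis actP : isometric_action act.
Implicit Types (g h : G) (x y : X).

Lemma act1 x : act 1%g x = x. Proof. by case: actP. Qed.

Lemma actM g h x : act (g * h)%g x = act g (act h x). Proof. by case: actP. Qed.

Lemma act_dist g x y : d (act g x) (act g y) = d x y.
Proof. by case: actP => _ _; apply. Qed.

Lemma actK g : cancel (act g) (act g^-1%g).
Proof. by move=> x; rewrite -actM mulVg act1. Qed.

Lemma actKV g : cancel (act g^-1%g) (act g).
Proof. by move=> x; rewrite -actM mulgV act1. Qed.

Lemma act_distV g x y : d (act g^-1%g x) y = d x (act g y).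
Proof. by rewrite -(act_dist g) actKV. Qed.

Lemma act_continuous g : continuous (act g).
Proof.
move=> x B /nbhs_ballP[e /= e0 eB].
apply: filterS (nbhs_mdist x e0) => y /= xy; apply: eB.
by rewrite ballEmdist /= act_dist.
Qed.

Lemma act_compact g (K : set X) : compact K -> compact (act g @` K).
Proof.
by apply: continuous_compact; apply: continuous_subspaceT; exact: act_continuous.
Qed.

End IsometricAction.

Section GeometricAction.
Context {R : realType} {G : groupType} {X : metricType R} {act : G -> X -> X}.
Hypothesis geoX : geodesic_space X.
Hypothesis actP : isometric_action act.
Hypothesis properA : proper_action act.
Hypothesis cocompactA : cocompact_action act.
Implicit Types (g h s : G) (x y z : X).

Let geodesic_interpolation x y (a b : R) : 0 <= a -> 0 <= b -> d x y <= a + b ->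
  exists z, d x z <= a /\ d z y <= b.
Proof.
move=> a0 b0 xy; have [c [c0 cD cE]] := geoX x y.
have D0 := mdist_ge0 x y.
have [aD|Da] := leP a (d x y).
  have aI : a \in `[0, d x y] by rewrite in_itv/= a0 aD.
  have I0 : 0 \in `[0, d x y] by rewrite in_itv/= lexx D0.
  have ID : d x y \in `[0, d x y] by rewrite in_itv/= lexx D0.
  exists (c a); rewrite -[in d x _]c0 -[in d _ y]cD !cE//.
  rewrite sub0r normrN ger0_norm// lexx distrC ger0_norm ?subr_ge0//; split=> //.
  lra.
by exists y; rewrite mdistxx b0 ltW.
Qed.

(** The radius r provided by properness at y controls the orbits of all points x: if
    g and h move x into the ball at y, then g h^-1 makes this ball meet itself. *)
Lemma proper_action_near y :
  exists2 r : R, 0 < r & forall x, finite_set [set g | d (act g x) y < r].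
Proof.
have [r r0 fin] := properA y; exists r => // x.
have [[g0 g0y]|none] := pselect (exists g, d (act g x) y < r); last first.
  by rewrite (_ : [set _ | _] = set0) ?finite_set0// -subset0 => g gy;
    apply: none; exists g.
apply: (@sub_finite_set _ _ ((fun h => h * g0)%g @` [set g |
    (act g @` ball y r) `&` ball y r !=set0])).
  move=> g /= gy; exists (g * g0^-1)%g; last by rewrite mulgVK.
  exists (act g x); rewrite !ballEmdist; split => /=; last by rewrite metric_sym.
  exists (act g0 x); first by rewrite metric_sym.
  by rewrite actM// actK.
exact: finite_image.
Qed.

(** Compactness is applied twice: to the point k that is moved, for a fixed target,
    and then to the target k'. *)
Lemma finite_short_translates (K : set X) : compact K ->
  exists2 e : R, 0 < e & finite_set
    [set g | exists k k', [/\ K k, K k' & d (act g k) k' < e]].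
Proof.
move=> cK.
pose P (y : X) (A : set G) (e : R) (x : X) := forall g, d (act g x) y < e -> A g.
have Pmono y A A' e e' x : A `<=` A' -> e' <= e -> P y A e x -> P y A' e' x.
  by move=> AA' e'e PA g gx; apply/AA'/PA; exact: lt_le_trans e'e.
have one y : exists (A : set G) (e : R),
    [/\ finite_set A, 0 < e & K `<=` P y A e].
  apply: compact_finite_uniform => //; first exact: Pmono.
  move=> x Kx; have [r r0 fin] := proper_action_near y.
  exists [set g | d (act g x) y < r], (r / 2); split => //.
    by rewrite divr_gt0.
  move=> x' xx' g /= gx'.
  have := metric_triangle (act g x) (act g x') y; rewrite act_dist//; lra.
have [] := @compact_finite_uniform _ _ G K
    (fun A e y => forall x, K x -> P y A e x) cK.
- by move=> A A' e e' y AA' e'e PA x Kx; apply: Pmono (PA x Kx).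
- move=> y Ky; have [A [e [fA e0 AP]]] := one y.
  exists A, (e / 2); split => //; first by rewrite divr_gt0.
  move=> y' yy' x Kx g gx; apply: (AP x Kx).
  have := metric_triangle (act g x) y' y; rewrite (metric_sym y'); lra.
move=> A [e [fA e0 AP]]; exists e => //; apply: sub_finite_set fA.
by move=> g [k [k' [Kk Kk' kk']]]; exact: (AP k' Kk' k Kk).
Qed.

(** Products of n + 1 elements of S: the element reached from k0 at distance 0 below
    is already an arbitrary element of S. *)
Fixpoint words (S : set G) (n : nat) : set G :=
  if n is n'.+1 then [set (p.1 * p.2)%g | p in words S n' `*` S] else S.

Lemma finite_words S n : finite_set S -> finite_set (words S n).
Proof.
by move=> fS; elim: n => //= n IH; apply/finite_image/finite_setX.
Qed.

(** A geodesic issued from k0, cut into pieces of length e, visits translates of K;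
    consecutive translates g K and h K are so close that h is the product of g and
    an element of the finite set S. This is the source of both finite generation
    and finiteness of the sets of elements with bounded displacement. *)
Lemma words_cover : (exists x : X, True) -> exists K S k0 (e : R),
  [/\ compact K, finite_set S & K k0] /\
  [/\ 0 < e, forall x, exists g, (act g @` K) x &
    forall n x g, d k0 x <= n%:R * e -> (act g @` K) x -> words S n g].
Proof.
move=> [x0 _]; have [K cK cover] := cocompactA.
have inK x : exists g, (act g @` K) x.
  have : [set: X] x by [].
  by rewrite -cover => -[g _ gx]; exists g.
have [e e0 fS] := finite_short_translates cK.
have [_ [k0 Kk0 _]] := inK x0.
have e20 : 0 < e / 2 by rewrite divr_gt0.
eexists K, _, k0, (e / 2); split; first by split; [|exact: fS|].
split=> //; elim=> [|n IH] x g /=.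
  rewrite mul0r => le0 [k Kk kx].
  have {le0}k0x : k0 = x.
    by apply: mdist_positivity; apply/eqP; rewrite eq_le le0 mdist_ge0.
  by exists k, k0; split => //; rewrite kx k0x mdistxx.
rewrite -natr1 mulrDl mul1r => k0x [k Kk kx].
have ne0 : 0 <= n%:R * (e / 2) by rewrite mulr_ge0// ltW.
have [y [k0y yx]] := geodesic_interpolation ne0 (ltW e20) k0x.
have [h hy] := inK y; exists (h, h^-1 * g)%g; last by rewrite /= mulVKg.
split=> /=; first exact: IH hy.
case: hy => k' Kk' ky; exists k, k'; split => //.
rewrite actM// act_distV// kx ky metric_sym (le_lt_trans yx)//; lra.
Qed.

Let archimedes (e r : R) : 0 < e -> exists n, r <= n%:R * e.
Proof.
move=> e0; exists (Num.trunc (r / e)).+1; rewrite -ler_pdivrMr// ltW//.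
exact: truncnS_gt.
Qed.

Lemma finitely_generated : (exists x : X, True) ->
  exists2 S : set G, finite_set S & generates S.
Proof.
move=> /words_cover[K [S [k0 [e [[cK fS Kk0] [e0 inK wP]]]]]].
exists S => // H H1 HS g.
have wH n : words S n `<=` H.
  elim: n => [s Ss|n IH _ [[h s] [/= /IH Hh Ss] <-]]; last exact: HS.
  by rewrite -(mul1g s); exact: HS.
have [n /wP nP] := archimedes (d k0 (act g k0)) e0.
by apply: (wH n); apply: nP; exists k0.
Qed.

Lemma finite_displacement x (r : R) : finite_set [set g | d (act g x) x <= r].
Proof.
have [K [S [k0 [e [[cK fS Kk0] [e0 inK wP]]]]]] := words_cover (ex_intro _ x I).
have [n nP] := archimedes (d k0 x + r + d x k0) e0.
apply: sub_finite_set (finite_words n fS) => g /= gx.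
apply: (wP n (act g k0)); last by exists k0.
apply: le_trans nP; rewrite (le_trans (metric_triangle _ (act g x) _))//.
rewrite act_dist// lerD2r (le_trans (metric_triangle _ x _))// lerD2l.
by rewrite metric_sym.
Qed.

Lemma compact_closed_ball z (r : R) : compact [set x | d z x <= r].
Proof.
have [K [S [k0 [e [[cK fS Kk0] [e0 inK wP]]]]]] := words_cover (ex_intro _ z I).
have [n nP] := archimedes (d k0 z + r) e0.
have [s sE] := (finite_seqP _).1 (finite_words n fS).
apply: (@subclosed_compact _ _ (\big[setU/set0]_(g <- s) (act g @` K))).
- exact: closed_ball_mdist.
- by apply: bigsetU_compact => g _; exact: act_compact.
move=> x /= zx; rewrite -bigcup_seq -sE; have [g gx] := inK x.
exists g => //; apply: wP gx; apply: le_trans nP.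
by rewrite (le_trans (metric_triangle _ z _))// lerD2l.
Qed.

Lemma cobounded x : exists2 D : R, 0 < D & forall y, exists g, d (act g x) y <= D.
Proof.
have [K [S [k0 [e [[cK _ _] [_ inK _]]]]]] := words_cover (ex_intro _ x I).
have [D D0 DP] := compact_mdist_bounded x cK; exists D => // y.
have [g [k Kk <-]] := inK y.
by exists g; rewrite act_dist// DP.
Qed.

Lemma geometric_complete : metric_complete [set: X].
Proof.
move=> u cu _; suff [l ul] : exists l, metric_lim u l by exists l.
have [N NP] := cu _ ltr01.
apply: compact_cauchy_lim (@compact_closed_ball (u N) 1) cu _.
by exists N => n Nn /=; rewrite ltW// NP.
Qed.

End GeometricAction.

(** * Minimal convex invariant sets and their copies *)

Section MinimalSet.
Context {R : realType} {G : groupType} {X : metricType R}.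
Variables (act : G -> X -> X) (pt : X -> X -> R -> X).
Hypothesis ptP : barycenter pt.
Hypothesis actP : isometric_action act.
Implicit Types (g : G) (x y z : X) (s : R) (A C : set X) (phi psi : X -> X).

Definition convex_invariant A : Prop :=
  [/\ closed A, barycenter_convex pt A &
      forall g x, A x -> A (act g x)].

Definition minimal_convex_invariant C : Prop :=
  [/\ C !=set0, convex_invariant C &
      forall A, A `<=` C -> A !=set0 -> convex_invariant A -> C `<=` A].

(** Zorn's lemma: an intersection of a chain is not empty since all members meet
    the compact set K. *)
Lemma minimal_convex_invariant_exists K (M : set X) : compact K ->
  M !=set0 -> convex_invariant M ->
  (forall A, A `<=` M -> A !=set0 -> (forall g x, A x -> A (act g x)) ->
    A `&` K !=set0) ->
  exists2 C, C `<=` M & minimal_convex_invariant C.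
Proof.
move=> cK M0 ciM meetK.
pose P A := [/\ A `<=` M, A !=set0 & convex_invariant A].
have PM : P M by split.
pose T := {A : set X | P A}.
pose rel (a b : T) := `[< sval b `<=` sval a >].
have [| | |[C [CM C0 ciC]] Cmax] := @ZL_preorder T (exist _ M PM) rel.
- by move=> a; apply/asboolP.
- by move=> b a c /asboolP ba /asboolP cb; apply/asboolP; exact: subset_trans ba.
- move=> F totF; have [[a0 Fa0]|none] := pselect (exists a, F a); last first.
    by exists (exist _ M PM) => a Fa; case: none; exists a.
  pose I := [set x | forall a, F a -> sval a x].
  suff PI : P I by exists (exist _ I PI) => a Fa; apply/asboolP => x; apply.
  split.
  + by move=> x Ix; case: (svalP a0) => + _ _; apply; exact: Ix.
  + have [|||x xP] := @compact_chain_bigcap _ _ K (sval @` F) cK.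
    * by exists (sval a0), a0.
    * move=> _ [a Fa <-]; have [aM an0 [ca _ ia]] := svalP a.
      by split => //; exact: meetK.
    * move=> _ _ [a Fa <-] [b Fb <-].
      by have [/asboolP|/asboolP] := totF _ _ Fa Fb; [right|left].
    by exists x => a Fa; apply: xP; exists a.
  + split.
    * apply/closed_mdistP => x xI a Fa.
      have [_ _ [/closed_mdistP ca _ _]] := svalP a.
      by apply: ca => e /xI[b Ib xb]; exists b => //; exact: Ib.
    * move=> x y s s0 s1 Ix Iy a Fa; have [_ _ [_ va _]] := svalP a.
      by apply: va => //; [exact: Ix|exact: Iy].
    * move=> g x Ix a Fa; have [_ _ [_ _ ia]] := svalP a.
      by apply: ia; exact: Ix.
exists C => //; split=> // A AC A0 ciA.
have PA : P A by split => //; exact: (subset_trans AC CM).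
by have /asboolP := Cmax (exist _ A PA) (asboolT AC).
Qed.

(** The sublevel sets of f inside C are empty or equal to C. *)
Lemma minimal_const C (f : X -> R) : minimal_convex_invariant C ->
  (forall r, convex_invariant (C `&` [set x | f x <= r])) ->
  forall x y, C x -> C y -> f x = f y.
Proof.
move=> [_ _ Cmin] ci; suff le x y : C x -> C y -> f x <= f y.
  by move=> x y Cx Cy; apply: le_anti; rewrite !le.
move=> Cx Cy.
have := Cmin (C `&` [set x | f x <= f y]) _ _ (ci _).
have sub : C `&` [set x | f x <= f y] `<=` C by move=> z [].
have n0 : C `&` [set x | f x <= f y] !=set0 by exists y; split => /=.
by move=> /(_ sub n0 _ Cx)[].
Qed.

(** Maps of C into X are represented by maps of X, considered up to their values
    outside C. *)
Definition equivariant_embedding C phi : Prop :=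
  {in C &, forall x y, d (phi x) (phi y) = d x y} /\
  forall g x, C x -> phi (act g x) = act g (phi x).

Section Embeddings.
Variable C : set X.
Hypothesis Cmin : minimal_convex_invariant C.
Hypothesis completeX : metric_complete [set: X].

Let Cclosed : closed C. Proof. by case: Cmin => _ []. Qed.
Let Cconv : barycenter_convex pt C. Proof. by case: Cmin => _ []. Qed.
Let Cinv g x : C x -> C (act g x).
Proof. by case: Cmin => _ [_ _ + _]; apply. Qed.

Lemma embedding_dist phi x y : equivariant_embedding C phi -> C x -> C y ->
  d (phi x) (phi y) = d x y.
Proof. by move=> [iso _] /mem_set Cx /mem_set Cy; exact: iso. Qed.

Lemma embedding_barycenter phi x y s : equivariant_embedding C phi ->
  0 <= s -> s <= 1 -> C x -> C y -> phi (pt x y s) = pt (phi x) (phi y) s.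
Proof.
move=> [iso _] s0 s1 Cx Cy.
by apply: (isometry_barycenter ptP iso) => //; exact: Cconv.
Qed.

Lemma closed_complete A : closed A -> metric_complete A.
Proof.
move=> /closed_mdistP cA u cu uA; have [//|l _ ul] := completeX cu.
exists l => //; apply: cA => e /ul[N NP].
by exists (u N) => //; rewrite metric_sym; exact: NP.
Qed.

Lemma embedding_image_complete phi : equivariant_embedding C phi ->
  metric_complete (phi @` C).
Proof.
move=> emb u cu uC.
pose v n := projT1 (cid2 (uC n)).
have vC n : C (v n) by rewrite /v; case: cid2.
have vu n : phi (v n) = u n by rewrite /v; case: cid2.
have [|l Cl vl] := closed_complete Cclosed (u := v) _ vC.
  move=> e /cu[N NP]; exists N => m n Nm Nn.
  by rewrite -(embedding_dist emb)// !vu; exact: NP.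
exists (phi l); first by exists l.
move=> e /vl[N NP]; exists N => n /NP.
by rewrite -(embedding_dist emb)// vu.
Qed.

Lemma embedding_image_convex phi : equivariant_embedding C phi ->
  barycenter_convex pt (phi @` C).
Proof.
move=> emb _ _ s s0 s1 [x Cx <-] [y Cy <-]; exists (pt x y s).
  exact: Cconv.
exact: embedding_barycenter.
Qed.

(** The distance between phi and psi is an invariant function, with convex sublevel
    sets since both maps preserve barycenters. *)
Lemma embedding_dist_const phi psi : equivariant_embedding C phi ->
  equivariant_embedding C psi ->
  forall x y, C x -> C y -> d (phi x) (psi x) = d (phi y) (psi y).
Proof.
move=> ephi epsi; apply: (minimal_const (f := fun x => d (phi x) (psi x))) => //.
move=> r; split.
- apply/closed_mdistP => x xP.
  have Cx : C x by apply/(closed_mdistP C).1 => // e /xP[a [Ca _] xa]; exists a.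
  split=> //=; apply/ler_addgt0Pr => e e0.
  have e20 : 0 < e / 2 by rewrite divr_gt0.
  have [a [Ca /= ar] xa] := xP _ e20.
  have := metric_triangle (phi x) (phi a) (psi x).
  have := metric_triangle (phi a) (psi a) (psi x).
  rewrite (embedding_dist ephi)// (embedding_dist epsi)// (metric_sym a x); lra.
- move=> x y s s0 s1 [Cx /= xr] [Cy /= yr]; split; first exact: Cconv.
  rewrite /= !embedding_barycenter//.
  exact: barycenter_dist_le.
- move=> g x [Cx /= xr]; split; first exact: Cinv.
  by rewrite /= ephi.2// epsi.2// act_dist.
Qed.

End Embeddings.
End MinimalSet.

Lemma finite_set_bounded (R : realDomainType) (T : Type) (A : set T)
    (f : T -> R) : finite_set A -> exists B, forall t, A t -> f t <= B.
Proof.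
move=> /(finite_image f)/finite_seqP[l lE].
have [B BP] : exists B, forall r, r \in l -> r <= B.
  elim: (l) => [|r l' [B BP]]; first by exists 0.
  exists (Num.max r B) => r'; rewrite in_cons le_max => /orP[/eqP->|/BP->].
    by rewrite lexx.
  by rewrite orbT.
exists B => t At; apply: BP.
have : [set` l] (f t) by rewrite -lE; exists t.
by [].
Qed.

Section Rigidity.
Context {R : realType} {G : groupType} {X : metricType R}.
Variables (act : G -> X -> X) (pt : X -> X -> R -> X).
Hypothesis ptP : barycenter pt.
Hypothesis actP : isometric_action act.
Hypothesis completeX : metric_complete [set: X].
Variable C : set X.
Hypothesis Cmin : minimal_convex_invariant act pt C.
Hypothesis displ : forall x (r : R), finite_set [set g | d (act g x) x <= r].
Variable S : set G.
Hypothesis finS : finite_set S.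
Hypothesis genS : generates S.
Hypothesis finZ : finite_set (@group_center G).
Hypothesis cobC :
  forall x, C x -> exists D : R, forall y, C y -> exists g, d (act g x) y <= D.
Implicit Types (g : G) (x y z : X) (phi psi tau : X -> X).

Notation embedding := (equivariant_embedding act C).

Let Cclosed : closed C. Proof. by case: Cmin => _ []. Qed.
Let Cconv : barycenter_convex pt C. Proof. by case: Cmin => _ []. Qed.
Let Cinv g x : C x -> C (act g x).
Proof. by case: Cmin => _ [_ _ + _]; apply. Qed.

Lemma embedding_id : embedding id.
Proof. by split. Qed.

Lemma embedding_comp tau phi : embedding phi -> embedding tau ->
  (forall x, C x -> C (tau x)) -> embedding (phi \o tau).
Proof.
move=> ephi etau Ctau; split=> [x y /set_mem Cx /set_mem Cy|g x Cx] /=.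
  rewrite (embedding_dist ephi) ?(embedding_dist etau)//; exact: Ctau.
by rewrite etau.2// ephi.2//; exact: Ctau.
Qed.

(** The midpoint m of x and tau x is moved by tau to the midpoint of tau x and
    tau (tau x), and m is displaced as much as x. *)
Lemma displacement_double tau x : embedding tau ->
  (forall x, C x -> C (tau x)) -> C x ->
  2 * d x (tau x) <= d x (tau (tau x)).
Proof.
move=> etau Ctau Cx.
have h0 : 0 <= 2^-1 :> R by rewrite invr_ge0.
have h1 : 2^-1 <= 1 :> R by rewrite invf_le1// ler1n.
have Cm : C (pt x (tau x) 2^-1) by apply: Cconv => //; exact: Ctau.
have -> : d x (tau x) = d (pt x (tau x) 2^-1) (tau (pt x (tau x) 2^-1)).
  exact: (embedding_dist_const ptP actP Cmin embedding_id etau).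
rewrite (embedding_barycenter ptP Cmin etau)//; last exact: Ctau.
exact: midline.
Qed.

(** This is where the finite center enters the geometry. By minimality tau displaces
    all points of C by the same amount; if it were positive, the iterates of tau of
    order 2 ^ n would have unbounded displacements. Cocompactness approximates each
    iterate by a group element on the orbit of x. As tau commutes with the action,
    these approximations have, by properness, finitely many conjugates of each
    generator, so that they are finitely many: a contradiction. *)
Lemma equivariant_selfmap_id tau : embedding tau ->
  (forall x, C x -> C (tau x)) -> forall x, C x -> tau x = x.
Proof.
move=> etau Ctau x Cx; apply/esym/mdist_positivity/eqP.
rewrite eq_le mdist_ge0 andbT leNgt; apply/negP => c0.
(* sigma n is the iterate of tau of order 2 ^ n *)
pose sigma := fix sigma n := if n is n'.+1 then sigma n' \o sigma n' else tau.
have sigmaP n : embedding (sigma n) /\ forall y, C y -> C (sigma n y).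
  elim: n => //= n [en Cn]; split; first exact: embedding_comp.
  by move=> y Cy; apply/Cn/Cn.
have grow n : 2 ^+ n * d x (tau x) <= d x (sigma n x).
  elim: n => [|n IH]; first by rewrite expr0 mul1r.
  have [en Cn] := sigmaP n.
  have := displacement_double en Cn Cx.
  rewrite exprS /=; lra.
have [D DP] := cobC Cx.
pose A := [set g | exists n, d (act g x) (sigma n x) <= D].
have finA : finite_set A.
  apply: (finite_of_finite_conjugates finS genS finZ) => s _.
  apply: sub_finite_set (displ x (D + D + d (act s x) x)).
  move=> _ [g [n gn] <-] /=; have [en Cn] := sigmaP n.
  rewrite -mulgA actM// act_distV// actM//.
  rewrite (le_trans (metric_triangle _ (act s (sigma n x)) _))//.
  rewrite act_dist// -addrA lerD// -en.2//.
  rewrite (le_trans (metric_triangle _ (sigma n x) _))// addrC lerD//.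
    by rewrite (embedding_dist en)//; exact: Cinv.
  by rewrite metric_sym.
have [B BP] := finite_set_bounded (fun g => d (act g x) x) finA.
pose n := Num.trunc ((D + B) / d x (tau x)).
have [g gn] := DP _ ((sigmaP n).2 _ Cx).
have gB := BP g (ex_intro _ n gn).
have big : D + B < 2 ^+ n * d x (tau x).
  rewrite -ltr_pdivrMr//; apply: lt_le_trans (truncnS_gt _) _.
  by rewrite -natrX ler_nat ltn_expl.
have := grow n; have := metric_triangle x (act g x) (sigma n x).
rewrite (metric_sym x (act g x)); lra.
Qed.

(** A flat strip theorem. By minimality all points of phi(C) are at the same
    distance a from psi(C), so that phi x is also the point of phi(C) nearest to its
    own projection psi (tau x). Thus the quadrilateral phi x, phi y, psi (tau y),
    psi (tau x) has four obtuse angles and must be a flat rectangle. In particular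
    tau is an equivariant isometric selfmap of C, hence the identity. *)
Lemma embeddings_parallel phi psi : embedding phi -> embedding psi ->
  exists2 a, 0 <= a & forall x y, C x -> C y ->
    d (phi x) (psi y) ^+ 2 = a ^+ 2 + d x y ^+ 2.
Proof.
move=> ephi epsi; have [[x0 Cx0] _ _] := Cmin.
have near x : exists t, C t /\
    forall z, C z -> d (phi x) (psi t) <= d (phi x) (psi z).
  have [|_ [[t Ct <-] tmin]] := nearest_exists ptP (phi x)
    (embedding_image_complete Cmin completeX epsi)
    (embedding_image_convex ptP Cmin epsi).
    by exists (psi x0), x0.
  by exists t; split=> // z Cz; apply: tmin; exists z.
have [tau tauP] := choice near.
have Ctau x : C (tau x) by case: (tauP x).
have tmin x z : C z -> d (phi x) (psi (tau x)) <= d (phi x) (psi z).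
  by case: (tauP x) => _; apply.
have fconst : forall x y, C x -> C y ->
    d (phi x) (psi (tau x)) = d (phi y) (psi (tau y)).
  apply: (minimal_const (f := fun x => d (phi x) (psi (tau x))) Cmin) => r.
  split.
  - apply/closed_mdistP => x xP.
    have Cx : C x by apply/(closed_mdistP C).1 => // e /xP[a [Ca _] xa]; exists a.
    split=> //=; apply/ler_addgt0Pr => e /xP[a [Ca /= ar] xa].
    have := metric_triangle (phi x) (phi a) (psi (tau a)).
    have := tmin x (tau a) (Ctau a).
    rewrite (embedding_dist ephi)//; lra.
  - move=> x y s s0 s1 [Cx /= xr] [Cy /= yr]; split; first exact: Cconv.
    apply: le_trans (tmin _ (pt (tau x) (tau y) s) _) _; first exact: Cconv.
    rewrite !(embedding_barycenter ptP Cmin)//.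
    exact: barycenter_dist_le.
  - move=> g x [Cx /= xr]; split; first exact: Cinv.
    apply: le_trans (tmin _ (act g (tau x)) _) _; first exact: Cinv.
    by rewrite /= ephi.2// epsi.2// act_dist.
pose a := d (phi x0) (psi (tau x0)).
have aE x : C x -> d (phi x) (psi (tau x)) = a by move=> Cx; exact: fconst.
have npsi x : nearest (psi @` C) (phi x) (psi (tau x)).
  by split; [exists (tau x)|move=> _ [z Cz <-]; exact: tmin].
have nphi x : C x -> nearest (phi @` C) (psi (tau x)) (phi x).
  move=> Cx; split; first by exists x.
  move=> _ [z Cz <-]; rewrite metric_sym (metric_sym _ (phi z)) aE// -(aE z)//.
  exact: tmin.
have vpsi := embedding_image_convex ptP Cmin epsi.
have vphi := embedding_image_convex ptP Cmin ephi.
have key x y : C x -> C y -> d (tau x) (tau y) ^+ 2 = d x y ^+ 2 /\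
    d (phi x) (psi (tau y)) ^+ 2 = a ^+ 2 + d x y ^+ 2.
  move=> Cx Cy.
  have im_psi z : (psi @` C) (psi (tau z)) by exists (tau z).
  have im_phi z : C z -> (phi @` C) (phi z) by exists z.
  (* the four obtuse angles, against the upper bound for the diagonals *)
  have := nearest_sqr ptP vpsi (npsi x) (im_psi y).
  have := nearest_sqr ptP vpsi (npsi y) (im_psi x).
  have := nearest_sqr ptP vphi (nphi x Cx) (im_phi y Cy).
  have := nearest_sqr ptP vphi (nphi y Cy) (im_phi x Cx).
  have := quadrilateral ptP (phi x) (phi y) (psi (tau y)) (psi (tau x)).
  rewrite (metric_sym (psi (tau y)) (psi (tau x))).
  rewrite !(metric_sym (psi _) (phi _)).
  rewrite (embedding_dist ephi Cx Cy) (embedding_dist ephi Cy Cx) !aE//.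
  rewrite !(embedding_dist epsi (Ctau _) (Ctau _)).
  rewrite (metric_sym y x); lra.
have etau : embedding tau.
  split=> [x y /set_mem Cx /set_mem Cy|g x Cx].
    apply/eqP; rewrite -(@eqrXn2 _ 2)// ?mdist_ge0//; apply/eqP.
    exact: (key x y Cx Cy).1.
  apply: mdist_positivity; rewrite -(embedding_dist epsi)//; last exact: Cinv.
  rewrite (_ : psi (tau _) = psi (act g (tau x))) ?mdistxx//.
  apply: (nearest_unique ptP vpsi (npsi _)); split.
    by exists (act g (tau x)) => //; exact: Cinv.
  move=> _ [z Cz <-]; rewrite ephi.2// epsi.2// act_dist// aE//.
  by rewrite -(aE (act g x)) ?ephi.2 -?ephi.2//; [exact: tmin|exact: Cinv].
exists a; first exact: mdist_ge0.
move=> x y Cx Cy; have <- := (key x y Cx Cy).2.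
by rewrite (equivariant_selfmap_id etau (fun z _ => Ctau z) Cy).
Qed.

End Rigidity.

Section MetricLimits.
Context {R : realType} {X : metricType R}.
Implicit Types (u v : nat -> X) (l : X).

Lemma metric_lim_dist u v l l' (c : R) : metric_lim u l -> metric_lim v l' ->
  (forall n, d (u n) (v n) = c) -> d l l' = c.
Proof.
move=> ul vl uv; apply/le_anti/andP; split; apply/ler_addgt0Pr => e e0.
all: have e20 : 0 < e / 2 by rewrite divr_gt0.
all: have [N /(_ _ (leq_maxl _ _)) uN] := ul _ e20.
all: have [N' /(_ _ (leq_maxr _ _)) vN] := vl _ e20.
- have := metric_triangle l (u (maxn N N')) l'.
  have := metric_triangle (u (maxn N N')) (v (maxn N N')) l'.
  rewrite uv (metric_sym l (u _)); move: (uN N') (vN N); lra.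
- have := metric_triangle (u (maxn N N')) l (v (maxn N N')).
  have := metric_triangle l l' (v (maxn N N')).
  rewrite uv (metric_sym l' (v _)); move: (uN N') (vN N); lra.
Qed.

Lemma metric_cauchy_le (Y : metricType R) u (v : nat -> Y) : metric_cauchy u ->
  (forall m n, d (v m) (v n) <= d (u m) (u n)) -> metric_cauchy v.
Proof.
move=> cu vu e /cu[N NP]; exists N => m n Nm Nn.
exact: le_lt_trans (vu _ _) (NP _ _ Nm Nn).
Qed.

Lemma metric_lim_cauchy u l : metric_lim u l -> metric_cauchy u.
Proof.
move=> ul e e0; have e20 : 0 < e / 2 by rewrite divr_gt0.
have [N NP] := ul _ e20; exists N => m n /NP ml /NP nl.
have := metric_triangle (u m) l (u n); rewrite (metric_sym l); lra.
Qed.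

End MetricLimits.

Section UnionOfCopies.
Context {R : realType} {G : groupType} {X : metricType R}.
Variables (act : G -> X -> X) (pt : X -> X -> R -> X).
Hypothesis ptP : barycenter pt.
Hypothesis actP : isometric_action act.
Hypothesis completeX : metric_complete [set: X].
Variable C : set X.
Hypothesis Cmin : minimal_convex_invariant act pt C.
Implicit Types (g : G) (x y z : X) (s : R) (phi psi : X -> X).

Notation embedding := (equivariant_embedding act C).

Hypothesis parallel : forall phi psi, embedding phi -> embedding psi ->
  exists2 a, 0 <= a & forall x y, C x -> C y ->
    d (phi x) (psi y) ^+ 2 = a ^+ 2 + d x y ^+ 2.

Let Cclosed : closed C. Proof. by case: Cmin => _ []. Qed.
Let Cconv : barycenter_convex pt C. Proof. by case: Cmin => _ []. Qed.
Let Cinv g x : C x -> C (act g x).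
Proof. by case: Cmin => _ [_ _ + _]; apply. Qed.

Lemma parallel_dist phi psi x y : embedding phi -> embedding psi ->
  C x -> C y ->
  d (phi x) (psi y) ^+ 2 = d (phi x) (psi x) ^+ 2 + d x y ^+ 2.
Proof.
move=> ephi epsi Cx Cy; have [a a0 aP] := parallel ephi epsi.
by rewrite !aP// mdistxx expr0n addr0.
Qed.

Lemma parallel_const phi psi x y : embedding phi -> embedding psi ->
  C x -> C y -> d (phi x) (psi x) = d (phi y) (psi y).
Proof.
by move=> ephi epsi; exact: (embedding_dist_const ptP actP Cmin).
Qed.

Lemma parallel_le phi psi x y z : embedding phi -> embedding psi ->
  C x -> C y -> C z -> d (phi z) (psi z) <= d (phi x) (psi y).
Proof.
move=> ephi epsi Cx Cy Cz; apply: le_of_sqr; first exact: mdist_ge0.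
rewrite (parallel_dist ephi epsi Cx Cy) (parallel_const ephi epsi Cz Cx).
by rewrite lerDl sqr_ge0.
Qed.

Definition copies : set X :=
  [set z | exists phi x, [/\ embedding phi, C x & phi x = z]].

(** If phi_n x_n converges, the Pythagorean formula makes both the points x_n of C
    and the embeddings phi_n converge, the latter uniformly. *)
Lemma copies_closed : closed copies.
Proof.
apply/closed_mdistP => z zP.
have ex n : exists p : (X -> X) * X,
    [/\ embedding p.1, C p.2 & d z (p.1 p.2) < n.+1%:R^-1].
  have n0 : 0 < n.+1%:R^-1 :> R by rewrite invr_gt0.
  by have [_ [phi [x [ephi Cx <-]]] zx] := zP _ n0; exists (phi, x).
have [p pP] := choice ex.
pose phi n := (p n).1; pose x n := (p n).2.
have ephi n : embedding (phi n) by case: (pP n).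
have Cx n : C (x n) by case: (pP n).
have zlim : metric_lim (fun n => phi n (x n)) z.
  move=> e e0; exists (Num.trunc e^-1) => n Nn; have [_ _] := pP n.
  rewrite metric_sym => /lt_le_trans; apply.
  rewrite -[leRHS]invrK lef_pV2 ?posrE ?invr_gt0//.
  by rewrite ltW// (lt_le_trans (truncnS_gt _))// ler_nat ltnS.
have cz := metric_lim_cauchy zlim.
have [|l Cl xl] := closed_complete completeX Cclosed (u := x) _ Cx.
  apply: metric_cauchy_le cz _ => m n; apply: le_of_sqr; first exact: mdist_ge0.
  by rewrite (parallel_dist (ephi m) (ephi n))// lerDr sqr_ge0.
have limphi y : exists l, C y -> metric_lim (phi ^~ y) l.
  have [Cy|nCy] := pselect (C y); last by exists y.
  have [|//|l' _ ly] := completeX (u := phi ^~ y) _; last by exists l'.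
  by apply: metric_cauchy_le cz _ => m n; exact: parallel_le.
have [psi psiP] := choice limphi.
exists psi, l; split=> //.
  split=> [x1 x2 /set_mem Cx1 /set_mem Cx2|g x1 Cx1].
    apply: metric_lim_dist (psiP _ Cx1) (psiP _ Cx2) _ => n.
    exact: embedding_dist.
  apply: mdist_positivity.
  have lim1 : metric_lim (fun n => act g (phi n x1)) (act g (psi x1)).
    by move=> e /(psiP _ Cx1)[N NP]; exists N => n /NP; rewrite act_dist.
  apply: metric_lim_dist (psiP _ (Cinv g Cx1)) lim1 _ => n.
  by rewrite (ephi n).2// mdistxx.
apply: mdist_positivity; apply: metric_lim_dist (psiP _ Cl) _ (fun=> mdistxx _).
move=> e e0; have e20 : 0 < e / 2 by rewrite divr_gt0.
have [N NP] := xl _ e20; have [N' N'P] := zlim _ e20.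
exists (maxn N N') => n; rewrite geq_max => /andP[/NP xn /N'P zn].
have := metric_triangle (phi n l) (phi n (x n)) z.
rewrite (embedding_dist (ephi n))// (metric_sym l); lra.
Qed.

(** The interpolated map chi is 1-Lipschitz by convexity of the metric. It does not
    shrink distances either: phi z is the point of phi(C) nearest to chi z, so that
    the diagonals of the quadrilateral phi x, chi x, chi y, phi y are long. *)
Lemma interpolate_embedding phi psi s : embedding phi -> embedding psi ->
  0 <= s -> s <= 1 -> embedding (fun z => pt (phi z) (psi z) s).
Proof.
move=> ephi epsi s0 s1; set chi := fun z => _.
have chiP z : d (phi z) (chi z) = s * d (phi z) (psi z) /\
    d (chi z) (psi z) = (1 - s) * d (phi z) (psi z).
  exact: dist_barycenter.
split=> [x y /set_mem Cx /set_mem Cy|g z Cz]; last first.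
  rewrite /chi ephi.2// epsi.2//; apply/esym.
  apply: (isometry_barycenter ptP (X' := setT)) => // u v _ _.
  exact: act_dist.
apply/eqP; rewrite -(@eqrXn2 _ 2)// ?mdist_ge0// eq_le; apply/andP; split.
  apply: le_trans (barycenter_sqr_convex ptP _ _ _ _ s0 s1) _.
  rewrite (embedding_dist ephi)// (embedding_dist epsi)//; lra.
have near z : C z -> nearest (phi @` C) (chi z) (phi z).
  move=> Cz; split; [by exists z|move=> _ [w Cw <-]].
  have [e1 e2] := chiP z.
  have := parallel_le ephi epsi Cw Cz Cz.
  have := metric_triangle (phi w) (chi z) (psi z).
  rewrite (metric_sym (chi z) (phi z)) (metric_sym (chi z) (phi w)) e1 e2.
  lra.
have vphi := embedding_image_convex ptP Cmin ephi.
have im z : C z -> (phi @` C) (phi z) by exists z.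
have := nearest_sqr ptP vphi (near x Cx) (im y Cy).
have := nearest_sqr ptP vphi (near y Cy) (im x Cx).
have := quadrilateral ptP (phi x) (chi x) (chi y) (phi y).
rewrite !(metric_sym (chi _) (phi _)) (embedding_dist ephi Cx Cy).
rewrite (embedding_dist ephi Cy Cx) (metric_sym y x); lra.
Qed.

(** In the flat rectangle spanned by phi and psi, the point of ratio s between phi x
    and psi y lies on the interpolated copy of ratio s, above the point of ratio s
    between x and y. *)
Lemma copies_convex : barycenter_convex pt copies.
Proof.
move=> _ _ s s0 s1 [phi [x [ephi Cx <-]]] [psi [y [epsi Cy <-]]].
have echi := interpolate_embedding ephi epsi s0 s1.
set chi := (fun z => _) in echi.
have Cw : C (pt x y s) by exact: Cconv.
exists chi, (pt x y s); split=> //.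
have [xw wy] := dist_barycenter ptP x y s0 s1.
have chiP z : d (phi z) (chi z) = s * d (phi z) (psi z) /\
    d (chi z) (psi z) = (1 - s) * d (phi z) (psi z).
  exact: dist_barycenter.
have sqr_eq (a b : R) : 0 <= a -> 0 <= b -> a ^+ 2 = b ^+ 2 -> a = b.
  by move=> a0 b0 /eqP; rewrite eqrXn2// => /eqP.
apply: barycenter_unique => //; apply: sqr_eq; rewrite ?mdist_ge0//.
- by rewrite mulr_ge0// mdist_ge0.
- rewrite exprMn (parallel_dist ephi echi)// (parallel_dist ephi epsi)//.
  by rewrite (chiP x).1 xw; ring.
- by rewrite mulr_ge0 ?mdist_ge0// subr_ge0.
- rewrite exprMn (parallel_dist echi epsi)// (parallel_dist ephi epsi)//.
  by rewrite (chiP _).2 wy (parallel_const ephi epsi Cw Cx); ring.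
Qed.

End UnionOfCopies.

(** * Actions of a direct product *)

(** Named so that the metric is attached to this type only and not to all sigma
    types. *)
Definition subspace_of {R : realType} {X : metricType R} (A : set X) : Type :=
  {x : X | x \in A}.

Section SubspaceMetric.
Context {R : realType} {X : metricType R} (A : set X).

Definition subspace_dist (x y : subspace_of A) : R := d (sval x) (sval y).

Let dist_xx x : subspace_dist x x = 0. Proof. exact: mdistxx. Qed.

Let dist_positivity x y : subspace_dist x y = 0 -> x = y.
Proof. by move=> /mdist_positivity xy; exact: val_inj. Qed.

Let dist_sym x y : subspace_dist x y = subspace_dist y x.
Proof. exact: metric_sym. Qed.

Let dist_triangle y x z :
  subspace_dist x z <= subspace_dist x y + subspace_dist y z.
Proof. exact: metric_triangle. Qed.

HB.instance Definition _ := Choice.copy (subspace_of A) {x : X | x \in A}.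
HB.instance Definition _ := isMetric.Build R (subspace_of A)
  dist_xx dist_positivity dist_sym dist_triangle.

Lemma subspace_mdistE (x y : subspace_of A) : d x y = d (sval x) (sval y).
Proof. by []. Qed.

Definition subspace_map (f : X -> X) (fA : forall x, A x -> A (f x))
    (x : subspace_of A) : subspace_of A :=
  exist _ (f (sval x)) (mem_set (fA _ (set_mem (svalP x)))).

Lemma subspace_isometric_action (G : groupType) (act : G -> X -> X)
    (actA : forall g x, A x -> A (act g x)) : isometric_action act ->
  isometric_action (fun g => subspace_map (actA g)).
Proof.
move=> actP; split.
- by move=> x; apply: val_inj; exact: (act1 actP).
- by move=> g h x; apply: val_inj; exact: (actM actP).
- by move=> g x y; exact: (act_dist actP).
Qed.

End SubspaceMetric.

Section ProductGroup.
Context {R : realType} {G1 G2 : groupType} {X : metricType R}.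
Variable act : (G1 * G2)%type -> X -> X.
Hypothesis actP : isometric_action act.
Implicit Types (x y : X).

Definition actl (g1 : G1) : X -> X := act (g1, 1%g).
Definition actr (g2 : G2) : X -> X := act (1%g, g2).

Lemma actl_isometric : isometric_action actl.
Proof.
split=> [x|g h x|g x y]; last exact: (act_dist actP).
- exact: (act1 actP).
- rewrite /actl -(actM actP); congr act.
  by rewrite -[in LHS](mulg1 (1%g : G2)).
Qed.

Lemma actr_isometric : isometric_action actr.
Proof.
split=> [x|g h x|g x y]; last exact: (act_dist actP).
- exact: (act1 actP).
- rewrite /actr -(actM actP); congr act.
  by rewrite -[in LHS](mulg1 (1%g : G1)).
Qed.

Lemma actlr (g1 : G1) (g2 : G2) x : act (g1, g2) x = actl g1 (actr g2 x).
Proof.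
rewrite /actl /actr -(actM actP); congr act.
by rewrite -[in LHS](mulg1 g1) -[in LHS](mul1g g2).
Qed.

Lemma actrl (g1 : G1) (g2 : G2) x : act (g1, g2) x = actr g2 (actl g1 x).
Proof.
rewrite /actl /actr -(actM actP); congr act.
by rewrite -[in LHS](mul1g g1) -[in LHS](mulg1 g2).
Qed.

Lemma actlrC (g1 : G1) (g2 : G2) x : actl g1 (actr g2 x) = actr g2 (actl g1 x).
Proof. by rewrite -actlr actrl. Qed.

Lemma generates_fst (S : set (G1 * G2)%type) :
  generates S -> generates (fst @` S).
Proof.
move=> genS H H1 HS g1.
apply: (genS [set g | H g.1] _ _ (g1, 1%g)) => //= g s Hg Ss.
by apply: HS => //; exists s.
Qed.

Lemma generates_snd (S : set (G1 * G2)%type) :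
  generates S -> generates (snd @` S).
Proof.
move=> genS H H1 HS g2.
apply: (genS [set g | H g.2] _ _ (1%g, g2)) => //= g s Hg Ss.
by apply: HS => //; exists s.
Qed.

Lemma finite_center_fst : finite_set (@group_center (G1 * G2)%type) ->
  finite_set (@group_center G1).
Proof.
move=> fin; apply: sub_finite_set (finite_image fst fin) => z zC.
exists (z, 1%g) => // -[h1 h2].
by apply/eqP; rewrite xpair_eqE /= zC mul1g mulg1 !eqxx.
Qed.

Lemma finite_center_snd : finite_set (@group_center (G1 * G2)%type) ->
  finite_set (@group_center G2).
Proof.
move=> fin; apply: sub_finite_set (finite_image snd fin) => z zC.
exists (1%g, z) => // -[h1 h2].
by apply/eqP; rewrite xpair_eqE /= zC mul1g mulg1 !eqxx.
Qed.

Lemma finite_displacement_fst :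
  (forall x (r : R), finite_set [set g | d (act g x) x <= r]) ->
  forall x (r : R), finite_set [set g1 | d (actl g1 x) x <= r].
Proof.
move=> fin x r; apply: sub_finite_set (finite_image fst (fin x r)) => g gx.
by exists (g, 1%g).
Qed.

Lemma finite_displacement_snd :
  (forall x (r : R), finite_set [set g | d (act g x) x <= r]) ->
  forall x (r : R), finite_set [set g2 | d (actr g2 x) x <= r].
Proof.
move=> fin x r; apply: sub_finite_set (finite_image snd (fin x r)) => g gx.
by exists (1%g, g).
Qed.

(** The points x little displaced by the generators of G2 form a set on which G1
    acts cocompactly. Move x near x0 by (g1, g2); the conjugates by g2 of the
    generators then displace x0 little, so that they are finitely many, and the
    finiteness of the center of G2 leaves finitely many g2. *)
Lemma little_displaced_cobounded (S : set G2) (x0 : X) (D c : R) :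
  finite_set S -> generates S -> finite_set (@group_center G2) ->
  (forall x (r : R), finite_set [set g2 | d (actr g2 x) x <= r]) ->
  (forall y, exists g, d (act g x0) y <= D) ->
  exists D', forall x, (forall s, S s -> d (actr s x) x <= c) ->
    exists g1, d (actl g1 x0) x <= D'.
Proof.
move=> finS genS finZ displ cob.
have isor := actr_isometric; have isol := actl_isometric.
pose M := [set x | forall s, S s -> d (actr s x) x <= c].
pose A := [set g2 | exists g1 x, M x /\ d (act (g1, g2) x0) x <= D].
have finA : finite_set A.
  apply: (finite_of_finite_conjugates finS genS finZ) => s Ss.
  apply: sub_finite_set (displ x0 (D + c + D)).
  move=> _ [g2 [g1 [x [Mx gx]]] <-] /=.
  rewrite -mulgA (actM isor) (act_distV isor) (actM isor).
  rewrite -(act_dist isol g1) actlrC -!actlr.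
  set y := act (g1, g2) x0 in gx *; have := Mx s Ss.
  have := metric_triangle (actr s y) (actr s x) y.
  have := metric_triangle (actr s x) x y.
  rewrite (act_dist isor) (metric_sym x); lra.
have [B BP] := finite_set_bounded (fun g2 => d (actr g2 x0) x0) finA.
exists (B + D) => x Mx; have [[g1 g2] gx] := cob x; exists g1.
have := BP g2 (ex_intro _ g1 (ex_intro _ x (conj Mx gx))).
have := metric_triangle (actl g1 x0) (act (g1, g2) x0) x.
by rewrite actlr (act_dist isol) (metric_sym x0) -actlr; lra.
Qed.

Lemma little_displaced_convex_invariant (pt : X -> X -> R -> X)
    (S : set G2) (c : R) :
  barycenter pt -> convex_invariant actl pt
    [set x | forall s, S s -> d (actr s x) x <= c].
Proof.
move=> ptP; have isor := actr_isometric; have isol := actl_isometric.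
split.
- apply/closed_mdistP => x xP s Ss; apply/ler_addgt0Pr => e e0.
  have e20 : 0 < e / 2 by rewrite divr_gt0.
  have [a /(_ s Ss) aP xa] := xP _ e20.
  have := metric_triangle (actr s x) (actr s a) x.
  have := metric_triangle (actr s a) a x.
  rewrite (act_dist isor) (metric_sym a x); lra.
- move=> x y t t0 t1 xP yP s Ss.
  rewrite (isometry_barycenter ptP (X' := setT) _ t0 t1)//; last first.
    by move=> u v _ _; exact: (act_dist isor).
  by apply: barycenter_dist_le => //; [exact: xP|exact: yP].
- by move=> g x xP s /xP; rewrite -actlrC (act_dist isol).
Qed.

End ProductGroup.

(** * The splitting theorem *)

Theorem theorem2 (R : realType) (G1 G2 : groupType) (X : metricType R)
    (act : (G1 * G2)%type -> X -> X) :
  CAT0 X ->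
  geometric_action act ->
  finite_set (@group_center (G1 * G2)%type) ->
  exists X' : set X,
    [/\ closed X', geodesically_convex X', invariant_set act X',
        quasi_dense X' &
        exists (X1 X2 : metricType R) (f : l2prod X1 X2 -> X),
          splits_as X' f /\ is_product_action act f].
Proof.
move=> cat0 [actP properA cocompactA] finZ; have [geo _] := cat0.
have isol := actl_isometric actP; have isor := actr_isometric actP.
have [nonempty|empty] := pselect (exists x : X, True); last first.
  have no (x : X) : False by apply: empty; exists x.
  exists set0; split.
  - exact: closed0.
  - by move=> x.
  - by move=> g; rewrite image_set0.
  - by exists 1 => // x; case: (no x).
  - exists X, X, (fun p => p.1); split; first split.
    + by move=> p; case: (no p.1).
    + by rewrite -subset0 => x; case: (no x).
    + by exists (actl act), (actr act); split=> // g1 g2 x; case: (no x).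
have [x0 _] := nonempty.
have [pt ptP] := CAT0_barycenter cat0.
have completeX := geometric_complete geo actP properA cocompactA.
have displ := finite_displacement geo actP properA cocompactA.
have [S finS genS] := finitely_generated geo actP properA cocompactA nonempty.
have [D _ cob] := cobounded geo actP properA cocompactA x0.
have [c cP] := finite_set_bounded (fun s => d (actr act s x0) x0)
  (finite_image snd finS).
pose M := [set x | forall s, (snd @` S) s -> d (actr act s x) x <= c].
have Mx0 : M x0 by exact: cP.
have ciM := little_displaced_convex_invariant actP (snd @` S) c ptP.
have [D' cobM] := little_displaced_cobounded actP c (finite_image snd finS)
  (generates_snd genS) (finite_center_snd finZ) (finite_displacement_snd displ)
  cob.
have cball : compact [set x | d x0 x <= D'].
  exact: (compact_closed_ball geo actP properA cocompactA).
have [|A AM [a Aa] Ainv|C CM Cmin] :=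
  minimal_convex_invariant_exists cball _ ciM.
- by exists x0.
- have [g1 ga] := cobM a (AM a Aa).
  exists (actl act g1^-1%g a); split; first exact: Ainv.
  by rewrite /= metric_sym (act_distV isol) metric_sym.
have [[k Ck] [_ _ Cinv] _] := Cmin.
have cobC x : C x ->
    exists B, forall y, C y -> exists g, d (actl act g x) y <= B.
  move=> Cx; exists (d x x0 + D') => y Cy; have [g gy] := cobM y (CM y Cy).
  exists g; rewrite (le_trans (metric_triangle _ (actl act g x0) _))//.
  by rewrite (act_dist isol) lerD2l.
have parallel := embeddings_parallel ptP isol completeX Cmin
  (finite_displacement_fst displ) (finite_image fst finS) (generates_fst genS)
  (finite_center_fst finZ) cobC.
pose embedding := equivariant_embedding (actl act) C.
have emb_actr g2 phi : embedding phi -> embedding (actr act g2 \o phi).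
  move=> ephi; split=> [x y Cx Cy|g x Cx] /=.
    by rewrite (act_dist isor) ephi.1.
  by rewrite ephi.2// actlrC.
pose X' := copies (actl act) C.
have X'inv g z : X' z -> X' (act g z).
  move=> [phi [x [ephi Cx <-]]]; case: g => g1 g2.
  exists (actr act g2 \o phi), (actl act g1 x).
  by split; [exact: emb_actr|exact: Cinv|rewrite /= ephi.2// actrl].
exists X'; split.
- exact: (copies_closed ptP isol completeX Cmin parallel).
- apply: (barycenter_geodesically_convex ptP geo).
  exact: (copies_convex ptP isol Cmin parallel).
- move=> g; apply/seteqP; split=> [_ [z X'z <-]|z X'z]; first exact: X'inv.
  by exists (act g^-1%g z); [exact: X'inv|exact: (actKV actP)].
- have X'k : X' k by exists id, k; split=> //; exact: embedding_id.
  have [N N0 NP] := cobounded geo actP properA cocompactA k.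
  exists N => // x; have [g gx] := NP x.
  by exists (act g k); [exact: X'inv|rewrite metric_sym].
(* the second factor is the set of positions of the base point k of C in the
   copies of C; copy y is the embedding that puts k at y *)
pose T := [set y | exists2 phi, embedding phi & phi k = y].
have ex_copy y : exists phi, T y -> embedding phi /\ phi k = y.
  have [[phi ephi phik]|nT] := pselect (T y); first by exists phi.
  by exists id.
have [copy copyP] := choice ex_copy.
have copy_unique phi x : embedding phi -> C x -> copy (phi k) x = phi x.
  move=> ephi Cx.
  have [ecopy copyk] := copyP (phi k) (ex_intro2 _ _ phi ephi erefl).
  apply: mdist_positivity.
  by rewrite (parallel_const ptP isol Cmin ecopy ephi Cx Ck) copyk mdistxx.
have Tinv g2 y : T y -> T (actr act g2 y).
  by move=> [phi ephi <-]; exists (actr act g2 \o phi) => //; exact: emb_actr.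
pose f (p : l2prod (subspace_of C) (subspace_of T)) : X :=
  copy (sval p.2) (sval p.1).
exists (subspace_of C), (subspace_of T), f; split; first split.
- move=> [[x Cx] [y Ty]] [[x' Cx'] [y' Ty']].
  rewrite /f /= [RHS]/mdist /= /l2dist /= !subspace_mdistE /=.
  move/set_mem: Cx => Cx; move/set_mem: Cx' => Cx'.
  have [ey yk] := copyP y (set_mem Ty); have [ey' y'k] := copyP y' (set_mem Ty').
  rewrite -[LHS]ger0_norm ?mdist_ge0// -sqrtr_sqr; congr Num.sqrt.
  rewrite (parallel_dist parallel ey ey')//.
  by rewrite (parallel_const ptP isol Cmin ey ey' Cx Ck) yk y'k addrC.
- apply/seteqP; split=> [_ [[[x Cx] [y Ty]] _ <-]|_ [phi [x [ephi Cx <-]]]].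
    have [ey _] := copyP y (set_mem Ty).
    by exists (copy y), x; split=> //; exact: set_mem.
  have Tphi : T (phi k) by exists phi.
  exists (exist _ x (mem_set Cx), exist _ (phi k) (mem_set Tphi)) => //.
  exact: copy_unique.
exists (fun g => subspace_map (Cinv g)), (fun g => subspace_map (Tinv g)); split.
- exact: subspace_isometric_action.
- exact: subspace_isometric_action.
move=> g1 g2 [x Cx] [y Ty]; rewrite /f /=; move/set_mem: Cx => Cx.
have [ey yk] := copyP y (set_mem Ty).
have := copy_unique _ _ (emb_actr g2 _ ey) (Cinv g1 x Cx); rewrite /= yk => ->.
by rewrite ey.2// actrl.
Qed.
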